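(* Let $P\colon \mathcal{C}^{\mathrm{op}}\to \mathsf{InfSl}$ be a lex primary doctrine. Let $P^{\exists}$ be its full existential completion, $\mathsf{T}_{P^{\exists}}$ the category obtained from $P^{\exists}$ by the tripos-to-topos construction, $\mathcal{G}_P$ the category of points of $P$, and $\mathsf{E}_P:=(\mathcal{G}_P)_{\mathsf{ex}/\mathsf{lex}}$ the exact category of points of $P$. Then there is an equivalence of categories $$\mathsf{T}_{P^{\exists}}\equiv (\mathcal{G}_P)_{\mathsf{ex}/\mathsf{lex}}=\mathsf{E}_P .$$
   Context: A lex primary doctrine is a functor $P\colon \mathcal{C}^{\mathrm{op}}\to\mathsf{InfSl}$, where $\mathcal{C}$ has finite limits and $\mathsf{InfSl}$ is the category of inf-semilattices (posets with finite meets, including a top element) and their homomorphisms. For $f\colon A\to B$ write $P_f\colon P(B)\to P(A)$ for the action of $P$ on $f$, and $\top_A$ for the top of $P(A)$. A lex primary doctrine is full existential if for every arrow $f\colon A\to B$ of $\mathcal{C}$ the map $P_f$ has a left adjoint $\exists_f$, and these satisfy the Beck–Chevalley condition (for pullback squares) and Frobenius reciprocity. Category of points $\mathcal{G}_P$: objects are pairs $(A,\alpha)$ with $A\in\mathcal{C}$, $\alpha\in P(A)$; an arrow $(A,\alpha)\to(B,\beta)$ is an arrow $f\colon A\to B$ of $\mathcal{C}$ with $\alpha\le P_f(\beta)$. It has finite limits. Full existential completion $P^{\exists}\colon\mathcal{C}^{\mathrm{op}}\to\mathsf{InfSl}$: $P^{\exists}(A)$ is the poset reflection of the preorder whose elements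 are pairs $(B\xrightarrow{f}A,\alpha)$ with $\alpha\in P(B)$, where $(B\xrightarrow{f}A,\alpha)\le(C\xrightarrow{g}A,\beta)$ iff there is $h\colon B\to C$ with $f=gh$ and $\alpha\le P_h(\beta)$. For $f\colon A\to B$, $P^{\exists}_f(C\xrightarrow{g}B,\beta):=(D\xrightarrow{f^*g}A,P_{g^*f}(\beta))$, where $D$ is the pullback of $f$ and $g$ with projections $f^*g\colon D\to A$, $g^*f\colon D\to C$. $P^{\exists}$ is a full existential doctrine. Tripos-to-topos construction $\mathsf{T}_R$ of a full existential doctrine $R\colon \mathcal{C}^{\mathrm{op}}\to\mathsf{InfSl}$: objects are pairs $(A,\rho)$ with $\rho\in R(A\times A)$ satisfying symmetry $\rho\le R_{\langle\pi_2,\pi_1\rangle}(\rho)$ and transitivity $R_{\langle\pi_1,\pi_2\rangle}(\rho)\wedge R_{\langle\pi_2,\pi_3\rangle}(\rho)\le R_{\langle\pi_1,\pi_3\rangle}(\rho)$ (in $R(A\times A\times A)$). Arrows $(A,\rho)\to(B,\sigma)$ are $\phi\in R(A\times B)$ such that: (i) $\phi\le R_{\langle\pi_1,\pi_1\rangle}(\rho)\wedge R_{\langle\pi_2,\pi_2\rangle}(\sigma)$; (ii) $R_{\langle\pi_1,\pi_2\rangle}(\rho)\wedge R_{\langle\pi_1,\pi_3\rangle}(\phi)\le R_{\langle\pi_2,\pi_3\rangle}(\phi)$ over $A\times A\times B$; (iii) $R_{\langle\pi_2,\pi_3\rangle}(\sigma)\wedge R_{\langle\pi_1,\pi_2\rangle}(\phi)\le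 R_{\langle\pi_1,\pi_3\rangle}(\phi)$ over $A\times B\times B$; (iv) $R_{\langle\pi_1,\pi_2\rangle}(\phi)\wedge R_{\langle\pi_1,\pi_3\rangle}(\phi)\le R_{\langle\pi_2,\pi_3\rangle}(\sigma)$ over $A\times B\times B$; (v) $R_{\Delta_A}(\rho)\le\exists_{\pi_1}(\phi)$, with $\pi_1\colon A\times B\to A$. Composition is relational composition $\exists_{\langle\pi_1,\pi_3\rangle}(R_{\langle\pi_1,\pi_2\rangle}(\phi)\wedge R_{\langle\pi_2,\pi_3\rangle}(\psi))$, and the identity of $(A,\rho)$ is $\rho$. For a category $\mathcal{D}$ with finite limits, $\mathcal{D}_{\mathsf{ex}/\mathsf{lex}}$ denotes its exact completion in the sense of Carboni (the free exact category on the finite-limit category $\mathcal{D}$). *)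

(* Defs.v *)
From HB Require Import structures.
From mathcomp Require Import all_boot all_order.
From mathcomp Require Import generic_quotient boolp.

Set Implicit Arguments.
Unset Strict Implicit.
Unset Printing Implicit Defensive.

Import Order.TTheory.

Local Open Scope order_scope.
Local Open Scope quotient_scope.

Declare Scope cat_scope.
Delimit Scope cat_scope with cat.
Local Open Scope cat_scope.

Record category := Category {
  ob :> Type;
  hom : ob -> ob -> Type;
  idc : forall A, hom A A;
  comp : forall A B D, hom B D -> hom A B -> hom A D;
  compA : forall A B D E (h : hom D E) (g : hom B D) (f : hom A B),
    comp h (comp g f) = comp (comp h g) f;
  comp1c : forall A B (f : hom A B), comp (idc B) f = f;
  compc1 : forall A B (f : hom A B), comp f (idc A) = f
}.

Arguments hom {c} _ _.
Arguments idc {c} A.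
Arguments comp {c A B D} _ _.

Notation "g ∘ f" := (comp g f) (at level 40, left associativity) : cat_scope.

Record functor (C D : category) := Functor {
  fob :> C -> D;
  fhom : forall A B, hom A B -> hom (fob A) (fob B);
  fhom1 : forall A, fhom (idc A) = idc (fob A);
  fhomc : forall A B E (g : hom B E) (f : hom A B),
    fhom (g ∘ f) = fhom g ∘ fhom f
}.

Arguments fhom {C D} _ {A B} _.

Definition functor_id (C : category) : functor C C :=
  @Functor C C (fun A => A) (fun A B f => f) (fun=> erefl)
    (fun _ _ _ _ _ => erefl).

Lemma functor_comp1 (C D E : category) (G : functor D E) (F : functor C D) A :
  fhom G (fhom F (idc A)) = idc (G (F A)).
Proof. by rewrite !fhom1. Qed.

Lemma functor_compc (C D E : category) (G : functor D E) (F : functor C D)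
    X Y Z (g : hom Y Z) (f : hom X Y) :
  fhom G (fhom F (g ∘ f)) = fhom G (fhom F g) ∘ fhom G (fhom F f).
Proof. by rewrite !fhomc. Qed.

Definition functor_comp (C D E : category) (G : functor D E) (F : functor C D) :
    functor C E :=
  @Functor C E (fun A => G (F A)) (fun A B f => fhom G (fhom F f))
    (functor_comp1 G F) (functor_compc G F).

Definition is_iso (C : category) (A B : C) (f : hom A B) : Prop :=
  exists g : hom B A, g ∘ f = idc A /\ f ∘ g = idc B.

Definition naturally_isomorphic (C D : category) (F G : functor C D) : Prop :=
  exists eta : forall A, hom (F A) (G A),
    (forall A, is_iso (eta A)) /\
    (forall A B (f : hom A B), eta B ∘ fhom F f = fhom G f ∘ eta A).

Definition equivalent_categories (C D : category) : Prop :=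
  exists (F : functor C D) (G : functor D C),
    naturally_isomorphic (functor_comp G F) (functor_id C) /\
    naturally_isomorphic (functor_comp F G) (functor_id D).

Definition is_terminal (C : category) (T : C) : Prop :=
  forall A, exists! f : hom A T, True.

Definition is_product (C : category) (A B X : C) (p : hom X A) (q : hom X B) :
    Prop :=
  forall Y (f : hom Y A) (g : hom Y B),
    exists! h : hom Y X, p ∘ h = f /\ q ∘ h = g.

Definition is_pullback (C : category) (A B X D : C) (f : hom A X) (g : hom B X)
    (p : hom D A) (q : hom D B) : Prop :=
  f ∘ p = g ∘ q /\
  forall Y (u : hom Y A) (v : hom Y B), f ∘ u = g ∘ v ->
    exists! h : hom Y D, p ∘ h = u /\ q ∘ h = v.

(* Chosen finite limits.  Terminal object and pullbacks suffice; products are *)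
(* recorded separately because they are used all the time.                    *)
Record finite_limits (C : category) := FiniteLimits {
  one_ : C;
  one_terminal_ : is_terminal one_;
  prod_ : C -> C -> C;
  pr1_ : forall A B, hom (prod_ A B) A;
  pr2_ : forall A B, hom (prod_ A B) B;
  prod_product_ : forall A B, is_product (pr1_ A B) (pr2_ A B);
  pb_ : forall A B X, hom A X -> hom B X -> C;
  pb1_ : forall A B X (f : hom A X) (g : hom B X), hom (pb_ f g) A;
  pb2_ : forall A B X (f : hom A X) (g : hom B X), hom (pb_ f g) B;
  pb_pullback_ : forall A B X (f : hom A X) (g : hom B X),
    is_pullback f g (pb1_ f g) (pb2_ f g)
}.

Record lexcat := LexCat {
  lex_cat :> category;
  lex_lim : finite_limits lex_cat
}.

Section FiniteLimits.
Context {C : lexcat}.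

Definition one : C := one_ (lex_lim C).
Definition prodc (A B : C) : C := prod_ (lex_lim C) A B.
Definition pr1 {A B : C} : hom (prodc A B) A := pr1_ (lex_lim C) A B.
Definition pr2 {A B : C} : hom (prodc A B) B := pr2_ (lex_lim C) A B.
Definition pb {A B X : C} (f : hom A X) (g : hom B X) : C :=
  pb_ (lex_lim C) f g.
Definition pb1 {A B X : C} (f : hom A X) (g : hom B X) : hom (pb f g) A :=
  pb1_ (lex_lim C) f g.
Definition pb2 {A B X : C} (f : hom A X) (g : hom B X) : hom (pb f g) B :=
  pb2_ (lex_lim C) f g.

Lemma one_terminal : is_terminal one. Proof. exact: one_terminal_. Qed.

Lemma prodcP (A B : C) : is_product (@pr1 A B) (@pr2 A B).
Proof. exact: prod_product_. Qed.

Lemma pbP (A B X : C) (f : hom A X) (g : hom B X) :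
  is_pullback f g (pb1 f g) (pb2 f g).
Proof. exact: pb_pullback_. Qed.

Lemma pbE (A B X : C) (f : hom A X) (g : hom B X) :
  f ∘ pb1 f g = g ∘ pb2 f g.
Proof. by case: (pbP f g). Qed.

Definition pairc {Y A B : C} (f : hom Y A) (g : hom Y B) : hom Y (prodc A B) :=
  sval (cid (prodcP f g)).

End FiniteLimits.

Notation "A × B" := (prodc A B) (at level 39, left associativity) : cat_scope.
Notation "⟨ f , g ⟩" := (pairc f g) (at level 0) : cat_scope.

(* Projections of the triple product (A × B) × D. *)
Definition pr31 {C : lexcat} {A B D : C} : hom (A × B × D) A := pr1 ∘ pr1.
Definition pr32 {C : lexcat} {A B D : C} : hom (A × B × D) B := pr2 ∘ pr1.
Definition pr33 {C : lexcat} {A B D : C} : hom (A × B × D) D := pr2.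

Section FiniteLimitsTheory.
Context {C : lexcat}.
Implicit Types A B X Y Z : C.

Lemma pr1_pair Y A B (f : hom Y A) (g : hom Y B) : pr1 ∘ ⟨f, g⟩ = f.
Proof. by rewrite /pairc; case: cid => h [[]]. Qed.

Lemma pr2_pair Y A B (f : hom Y A) (g : hom Y B) : pr2 ∘ ⟨f, g⟩ = g.
Proof. by rewrite /pairc; case: cid => h [[]]. Qed.

Lemma prodc_ext Y A B (h k : hom Y (A × B)) :
  pr1 ∘ h = pr1 ∘ k -> pr2 ∘ h = pr2 ∘ k -> h = k.
Proof.
move=> e1 e2; have [m [_ um]] := prodcP (pr1 ∘ k) (pr2 ∘ k).
by rewrite -(um h) // -(um k).
Qed.

Lemma pairc_comp Z Y A B (f : hom Y A) (g : hom Y B) (h : hom Z Y) :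
  ⟨f, g⟩ ∘ h = ⟨f ∘ h, g ∘ h⟩.
Proof. by apply: prodc_ext; rewrite compA ?pr1_pair ?pr2_pair. Qed.

Lemma pairc_pr A B : ⟨pr1, pr2⟩ = idc (A × B).
Proof. by apply: prodc_ext; rewrite ?pr1_pair ?pr2_pair compc1. Qed.

Lemma pb_lift A B X Y (f : hom A X) (g : hom B X) (u : hom Y A) (v : hom Y B) :
  f ∘ u = g ∘ v -> exists h : hom Y (pb f g), pb1 f g ∘ h = u /\ pb2 f g ∘ h = v.
Proof. by case: (pbP f g) => _ + e => /(_ _ _ _ e)[h [? _]]; exists h. Qed.

End FiniteLimitsTheory.

(* tMeetSemilatticeType is the library's structure of posets with binary      *)
(* meets `&` and top \top; reindexI and reindexT make reindex a homomorphism. *)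
Record lex_primary_doctrine (d : Order.disp_t) (C : lexcat) := Doctrine {
  fib :> C -> tMeetSemilatticeType d;
  reindex : forall A B : C, hom A B -> fib B -> fib A;
  reindexI : forall (A B : C) (f : hom A B) (x y : fib B),
    reindex f (x `&` y) = reindex f x `&` reindex f y;
  reindexT : forall (A B : C) (f : hom A B), reindex f \top = \top;
  reindex1 : forall (A : C) (x : fib A), reindex (idc A) x = x;
  reindexc : forall (A B D : C) (g : hom B D) (f : hom A B) (x : fib D),
    reindex (g ∘ f) x = reindex f (reindex g x)
}.

Arguments reindex {d C} _ {A B} _ _.

(* x.[f] is P_f(x). *)
Notation "x .[ f ]" := (reindex _ f x) : cat_scope.

Record full_existential (d : Order.disp_t) (C : lexcat) (R : lex_primary_doctrine d C) :=
  FullExistential {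
  ex_ : forall A B : C, hom A B -> R A -> R B;
  ex_adjoint_ : forall (A B : C) (f : hom A B) (x : R A) (y : R B),
    (ex_ f x <= y) = (x <= y.[f]);
  beck_chevalley_ : forall (A B X D : C) (f : hom A X) (g : hom B X)
    (p : hom D A) (q : hom D B), is_pullback f g p q ->
    forall y : R B, (ex_ g y).[f] = ex_ p (y.[q]);
  frobenius_ : forall (A B : C) (f : hom A B) (x : R A) (y : R B),
    ex_ f (x `&` y.[f]) = ex_ f x `&` y
}.

Record exdoctrine (d : Order.disp_t) (C : lexcat) := ExDoctrine {
  ex_doc :> lex_primary_doctrine d C;
  ex_full : full_existential ex_doc
}.

Section ExDoctrine.
Context {d : Order.disp_t} {C : lexcat} {R : exdoctrine d C}.

Definition exq {A B : C} (f : hom A B) (x : R A) : R B := ex_ (ex_full R) f x.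

Lemma exq_adjoint (A B : C) (f : hom A B) (x : R A) (y : R B) :
  (exq f x <= y) = (x <= y.[f]).
Proof. exact: ex_adjoint_. Qed.

Lemma beck_chevalley (A B X D : C) (f : hom A X) (g : hom B X)
    (p : hom D A) (q : hom D B) : is_pullback f g p q ->
  forall y : R B, (exq g y).[f] = exq p (y.[q]).
Proof. exact: beck_chevalley_. Qed.

Lemma frobenius (A B : C) (f : hom A B) (x : R A) (y : R B) :
  exq f (x `&` y.[f]) = exq f x `&` y.
Proof. exact: frobenius_. Qed.

End ExDoctrine.

(* Proves x1 `&` ... `&` xn <= y when y is a meet of some of the xi. *)
Ltac meets :=
  match goal with
  | |- is_true (_ <= _ `&` _) => rewrite lexI; apply/andP; split; meets
  | |- is_true (_ <= \top) => exact: lex1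
  | |- _ => first [ exact: lexx | apply: leIxl; meets | apply: leIxr; meets ]
  end.

Section DoctrineTheory.
Context {d : Order.disp_t} {C : lexcat} {P : lex_primary_doctrine d C}.
Implicit Types A B X Y : C.

Lemma reindex_le A B (f : hom A B) (x y : P B) : x <= y -> x.[f] <= y.[f].
Proof. by move=> /meet_idPl e; apply/meet_idPl; rewrite -reindexI e. Qed.

Lemma sub2 X Y A B (u : hom Y A) (v : hom Y B) (h : hom X Y) (x : P (A × B)) :
  x.[⟨u, v⟩].[h] = x.[⟨u ∘ h, v ∘ h⟩].
Proof. by rewrite -reindexc pairc_comp. Qed.

Lemma sub2_id A B (x : P (A × B)) : x = x.[⟨pr1, pr2⟩].
Proof. by rewrite pairc_pr reindex1. Qed.

End DoctrineTheory.

Section Points.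
Context {d : Order.disp_t} {C : lexcat} (P : lex_primary_doctrine d C).

Record point := Point { pt_ob : C; pt_pred : P pt_ob }.

Definition pt_hom (a b : point) : Type :=
  {f : hom (pt_ob a) (pt_ob b) | pt_pred a <= (pt_pred b).[f]}.

Definition pt_mk (a b : point) (f : hom (pt_ob a) (pt_ob b))
  (le_f : pt_pred a <= (pt_pred b).[f]) : pt_hom a b :=
  exist (fun f => is_true (pt_pred a <= (pt_pred b).[f])) f le_f.

Lemma pt_id_subproof (a : point) : pt_pred a <= (pt_pred a).[idc (pt_ob a)].
Proof. by rewrite reindex1. Qed.

Definition pt_id (a : point) : pt_hom a a := pt_mk (pt_id_subproof a).

Lemma pt_comp_subproof (a b c : point) (g : pt_hom b c) (f : pt_hom a b) :
  pt_pred a <= (pt_pred c).[sval g ∘ sval f].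
Proof.
by rewrite reindexc; apply: le_trans (svalP f) (reindex_le _ (svalP g)).
Qed.

Definition pt_comp (a b c : point) (g : pt_hom b c) (f : pt_hom a b) :
  pt_hom a c := pt_mk (pt_comp_subproof g f).

Lemma pt_hom_ext (a b : point) (f g : pt_hom a b) : sval f = sval g -> f = g.
Proof. by move=> e; apply/val_inj. Qed.

Lemma pt_compA (a b c e : point) (h : pt_hom c e) (g : pt_hom b c)
    (f : pt_hom a b) : pt_comp h (pt_comp g f) = pt_comp (pt_comp h g) f.
Proof. by apply: pt_hom_ext; rewrite /= compA. Qed.

Lemma pt_comp1c (a b : point) (f : pt_hom a b) : pt_comp (pt_id b) f = f.
Proof. by apply: pt_hom_ext; rewrite /= comp1c. Qed.

Lemma pt_compc1 (a b : point) (f : pt_hom a b) : pt_comp f (pt_id a) = f.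
Proof. by apply: pt_hom_ext; rewrite /= compc1. Qed.

Definition points_category : category :=
  Category pt_compA pt_comp1c pt_compc1.

Local Notation G := points_category.

Definition pt_one : G := Point (\top : P one).

Lemma pt_one_terminal : is_terminal pt_one.
Proof.
move=> a; have [f [_ uf]] := one_terminal (pt_ob a).
have Pf : pt_pred a <= (pt_pred pt_one).[f] by rewrite reindexT lex1.
exists (@pt_mk a pt_one f Pf); split=> // g _.
by apply: pt_hom_ext; rewrite /= (uf (sval g)).
Qed.

Definition pt_prod (a b : G) : G :=
  Point ((pt_pred a).[pr1] `&` (pt_pred b).[pr2]).

Definition pt_pr1 (a b : G) : @hom G (pt_prod a b) a :=
  @pt_mk (pt_prod a b) a pr1 (leIl _ _).
Definition pt_pr2 (a b : G) : @hom G (pt_prod a b) b :=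
  @pt_mk (pt_prod a b) b pr2 (leIr _ _).

Lemma pt_prod_product (a b : G) : is_product (pt_pr1 a b) (pt_pr2 a b).
Proof.
move=> c f g.
have Ph : pt_pred c <= (pt_pred (pt_prod a b)).[⟨sval f, sval g⟩].
  rewrite reindexI -!reindexc pr1_pair pr2_pair lexI.
  by apply/andP; split; [exact: (svalP f) | exact: (svalP g)].
exists (@pt_mk c (pt_prod a b) _ Ph); split.
  by split; apply: pt_hom_ext; rewrite /= ?pr1_pair ?pr2_pair.
move=> k [kf kg]; apply: pt_hom_ext; rewrite /= -kf -kg /=.
by apply: prodc_ext; rewrite ?pr1_pair ?pr2_pair.
Qed.

Definition pt_pb (a b x : G) (f : hom a x) (g : hom b x) : G :=
  Point ((pt_pred a).[pb1 (sval f) (sval g)] `&`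
         (pt_pred b).[pb2 (sval f) (sval g)]).

Definition pt_pb1 (a b x : G) (f : hom a x) (g : hom b x) :
  @hom G (pt_pb f g) a := @pt_mk (pt_pb f g) a (pb1 (sval f) (sval g)) (leIl _ _).
Definition pt_pb2 (a b x : G) (f : hom a x) (g : hom b x) :
  @hom G (pt_pb f g) b := @pt_mk (pt_pb f g) b (pb2 (sval f) (sval g)) (leIr _ _).

Lemma pt_pb_pullback (a b x : G) (f : hom a x) (g : hom b x) :
  is_pullback f g (pt_pb1 f g) (pt_pb2 f g).
Proof.
have [e up] := pbP (sval f) (sval g).
split=> [|c u v euv]; first exact: pt_hom_ext.
have /up[h [[hu hv] uh]] : sval f ∘ sval u = sval g ∘ sval v.
  exact: (congr1 (fun k : pt_hom c x => sval k) euv).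
have Ph : pt_pred c <= (pt_pred (pt_pb f g)).[h].
  rewrite reindexI -!reindexc hu hv lexI.
  by apply/andP; split; [exact: (svalP u) | exact: (svalP v)].
exists (@pt_mk c (pt_pb f g) _ Ph); split.
  by split; apply: pt_hom_ext.
move=> k [ku kv]; apply: pt_hom_ext; apply: uh.
by rewrite -ku -kv.
Qed.

Definition points : lexcat :=
  LexCat (FiniteLimits pt_one_terminal pt_prod_product pt_pb_pullback).

End Points.

Record premeet := PreMeet {
  pm_car :> Type;
  pm_le : pm_car -> pm_car -> Prop;
  pm_le_refl : forall x, pm_le x x;
  pm_le_trans : forall y x z, pm_le x y -> pm_le y z -> pm_le x z;
  pm_meet : pm_car -> pm_car -> pm_car;
  pm_top : pm_car;
  pm_meetP : forall x y z, pm_le x (pm_meet y z) <-> pm_le x y /\ pm_le x z;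
  pm_topP : forall x, pm_le x pm_top
}.

Section PosetReflection.
Variable Q : premeet.

Definition pm_eqv (x y : {classic Q}) : bool :=
  `[< pm_le x y /\ @pm_le Q y x >].

Lemma pm_eqv_refl : reflexive pm_eqv.
Proof. by move=> x; apply/asboolP; split; apply: pm_le_refl. Qed.

Lemma pm_eqv_sym : symmetric pm_eqv.
Proof. by move=> x y; apply/asboolP/asboolP => -[]. Qed.

Lemma pm_eqv_trans : transitive pm_eqv.
Proof.
move=> y x z /asboolP[xy yx] /asboolP[yz zy]; apply/asboolP; split.
  exact: pm_le_trans xy yz.
exact: pm_le_trans zy yx.
Qed.

Canonical pm_equiv_rel := EquivRel pm_eqv pm_eqv_refl pm_eqv_sym pm_eqv_trans.

(* d is phantom: it only selects the display of the order instances below. *)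
Definition prefl (d : Order.disp_t) : Type := {eq_quot pm_equiv_rel}.

Variable d : Order.disp_t.
Local Notation T := (prefl d).

HB.instance Definition _ := Choice.copy T {eq_quot pm_equiv_rel}.

Definition prefl_class (x : Q) : T :=
  \pi_({eq_quot pm_equiv_rel}) (x : {classic Q}).
Definition prefl_repr (x : T) : Q := repr (x : {eq_quot pm_equiv_rel}).
Definition prefl_le (x y : T) : bool :=
  `[< pm_le (prefl_repr x) (prefl_repr y) >].

Lemma prefl_reprK (x : T) : prefl_class (prefl_repr x) = x.
Proof. exact: (@reprK _ {eq_quot pm_equiv_rel}). Qed.

Lemma prefl_ind (S : T -> Prop) : (forall x, S (prefl_class x)) -> forall x, S x.
Proof. by move=> H x; rewrite -(prefl_reprK x). Qed.

Lemma prefl_classP (x y : Q) :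
  prefl_class x = prefl_class y <-> pm_le x y /\ pm_le y x.
Proof.
split=> [/eqP|H]; last by apply/eqP; rewrite eqmodE; apply/asboolP.
by rewrite eqmodE => /asboolP.
Qed.

Lemma class_repr_le (x : Q) :
  pm_le (prefl_repr (prefl_class x)) x /\ pm_le x (prefl_repr (prefl_class x)).
Proof. by apply/prefl_classP; rewrite prefl_reprK. Qed.

Lemma prefl_leE (x y : Q) :
  prefl_le (prefl_class x) (prefl_class y) <-> pm_le x y.
Proof.
have [xl xr] := class_repr_le x; have [yl yr] := class_repr_le y.
split=> [/asboolP H|H].
  exact: pm_le_trans xr (pm_le_trans H yl).
by apply/asboolP; exact: pm_le_trans xl (pm_le_trans H yr).
Qed.

Lemma prefl_le_refl : reflexive prefl_le.
Proof. by elim/prefl_ind => x; apply/prefl_leE; apply: pm_le_refl. Qed.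

Lemma prefl_le_anti : antisymmetric prefl_le.
Proof.
elim/prefl_ind => x; elim/prefl_ind => y /andP[/prefl_leE xy /prefl_leE yx].
exact/prefl_classP.
Qed.

Lemma prefl_le_trans : transitive prefl_le.
Proof.
elim/prefl_ind => y; elim/prefl_ind => x; elim/prefl_ind => z.
by move=> /prefl_leE xy /prefl_leE yz; apply/prefl_leE; apply: pm_le_trans xy yz.
Qed.

HB.instance Definition _ := Order.Le_isPOrder.Build d T
  prefl_le_refl prefl_le_anti prefl_le_trans.

Definition prefl_meet (x y : T) : T :=
  prefl_class (pm_meet (prefl_repr x) (prefl_repr y)).

Lemma prefl_meetP (x y z : T) :
  (x <= prefl_meet y z) = (x <= y) && (x <= z).
Proof.
rewrite -(prefl_reprK x) -{2}(prefl_reprK y) -{2}(prefl_reprK z).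
apply/idP/andP => [/prefl_leE/pm_meetP[? ?]|[/prefl_leE ? /prefl_leE ?]].
  by split; apply/prefl_leE.
by apply/prefl_leE/pm_meetP.
Qed.

HB.instance Definition _ := Order.POrder_isMeetSemilattice.Build d T prefl_meetP.

Lemma prefl_topP (x : T) : x <= prefl_class (pm_top Q).
Proof. by elim/prefl_ind: x => x; apply/prefl_leE; apply: pm_topP. Qed.

HB.instance Definition _ := Order.hasTop.Build d T prefl_topP.

Lemma prefl_classLE (x y : Q) :
  (prefl_class x <= prefl_class y) <-> pm_le x y.
Proof. exact: prefl_leE. Qed.

Lemma prefl_classI (x y : Q) :
  prefl_class x `&` prefl_class y = prefl_class (pm_meet x y).
Proof.
have [xl xr] := class_repr_le x; have [yl yr] := class_repr_le y.
have [m1 m2] := (pm_meetP _ x y).1 (pm_le_refl (pm_meet x y)).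
have [n1 n2] := (pm_meetP _ _ _).1
  (pm_le_refl (pm_meet (prefl_repr (prefl_class x)) (prefl_repr (prefl_class y)))).
apply/prefl_classP; split; apply/pm_meetP; split.
- exact: pm_le_trans n1 xl.
- exact: pm_le_trans n2 yl.
- exact: pm_le_trans m1 xr.
- exact: pm_le_trans m2 yr.
Qed.

Lemma prefl_classT : \top = prefl_class (pm_top Q).
Proof. by []. Qed.

End PosetReflection.

Arguments prefl_class {Q d} _.
Arguments prefl_repr {Q d} _.

(* The map of poset reflections induced by F; meaningful for monotone F. *)
Definition prefl_map (Q Q' : premeet) (d : Order.disp_t) (F : Q -> Q')
  (x : prefl Q d) : prefl Q' d := prefl_class (F (prefl_repr x)).

Lemma prefl_mapE (Q Q' : premeet) (d : Order.disp_t) (F : Q -> Q') :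
  (forall x y, pm_le x y -> pm_le (F x) (F y)) ->
  forall x, prefl_map F (prefl_class x : prefl Q d) = prefl_class (F x).
Proof.
by move=> mF x; apply/prefl_classP; have [? ?] := class_repr_le d x; split; apply: mF.
Qed.

Section FullExistentialCompletion.
Context {d : Order.disp_t} {C : lexcat} (P : lex_primary_doctrine d C).

(* The formal existential quantification along src_map of src_pred. *)
Record preex (A : C) := PreEx {
  src : C;
  src_map : hom src A;
  src_pred : P src
}.

Definition preex_le (A : C) (x y : preex A) : Prop :=
  exists h : hom (src x) (src y),
    src_map x = src_map y ∘ h /\ src_pred x <= (src_pred y).[h].

Definition preex_meet (A : C) (x y : preex A) : preex A :=
  let p := pb1 (src_map x) (src_map y) in
  let q := pb2 (src_map x) (src_map y) in
  PreEx (src_map x ∘ p) ((src_pred x).[p] `&` (src_pred y).[q]).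

Definition preex_top (A : C) : preex A := PreEx (idc A) \top.

Lemma preex_le_refl (A : C) (x : preex A) : preex_le x x.
Proof. by exists (idc _); rewrite compc1 reindex1. Qed.

Lemma preex_le_trans (A : C) (y x z : preex A) :
  preex_le x y -> preex_le y z -> preex_le x z.
Proof.
move=> [h [eh lh]] [k [ek lk]]; exists (k ∘ h); split.
  by rewrite compA -ek.
by rewrite reindexc; apply: le_trans lh (reindex_le _ lk).
Qed.

Lemma preex_meetP (A : C) (x y z : preex A) :
  preex_le x (preex_meet y z) <-> preex_le x y /\ preex_le x z.
Proof.
have e := pbE (src_map y) (src_map z).
split=> [[h [/= eh]]|[[h [eh lh]] [k [ek lk]]]].
  rewrite reindexI lexI -!reindexc => /andP[l1 l2].
  split; first by exists (pb1 (src_map y) (src_map z) ∘ h); rewrite compA.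
  by exists (pb2 (src_map y) (src_map z) ∘ h); rewrite compA -e.
have [m [m1 m2]] : exists m, pb1 (src_map y) (src_map z) ∘ m = h /\
    pb2 (src_map y) (src_map z) ∘ m = k by apply: pb_lift; rewrite -eh -ek.
exists m => /=; split; first by rewrite -compA m1.
by rewrite reindexI -!reindexc m1 m2 lexI lh.
Qed.

Lemma preex_topP (A : C) (x : preex A) : preex_le x (preex_top A).
Proof. by exists (src_map x); rewrite /= comp1c reindexT lex1. Qed.

Definition preex_premeet (A : C) : premeet :=
  PreMeet (@preex_le_refl A) (@preex_le_trans A) (@preex_meetP A)
    (@preex_topP A).

Definition preex_reindex (A B : C) (f : hom A B)
    (x : preex_premeet B) : preex_premeet A :=
  PreEx (pb1 f (src_map x)) (src_pred x).[pb2 f (src_map x)].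

Definition preex_ex (A B : C) (f : hom A B)
    (x : preex_premeet A) : preex_premeet B :=
  PreEx (f ∘ src_map x) (src_pred x).

Lemma preex_reindex_le (A B : C) (f : hom A B) (x : preex_premeet A)
    (y : preex_premeet B) :
  pm_le x (preex_reindex f y) <->
  exists h : hom (src x) (src y),
    f ∘ src_map x = src_map y ∘ h /\ src_pred x <= (src_pred y).[h].
Proof.
split=> [[h [/= -> l]]|[h [e l]]].
  exists (pb2 f (src_map y) ∘ h); rewrite reindexc; split=> //.
  by rewrite !compA pbE.
by have [k [k1 k2]] := pb_lift e; exists k; rewrite /= k1 -reindexc k2.
Qed.

Lemma preex_adjoint (A B : C) (f : hom A B) (x : preex_premeet A)
    (y : preex_premeet B) :
  pm_le (preex_ex f x) y <-> pm_le x (preex_reindex f y).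
Proof. by rewrite preex_reindex_le. Qed.

Lemma preex_reindex_mono (A B : C) (f : hom A B) (x y : preex_premeet B) :
  pm_le x y -> pm_le (preex_reindex f x) (preex_reindex f y).
Proof.
move=> xy; apply/preex_adjoint; apply: pm_le_trans xy.
by apply/preex_adjoint/pm_le_refl.
Qed.

Lemma preex_ex_mono (A B : C) (f : hom A B) (x y : preex_premeet A) :
  pm_le x y -> pm_le (preex_ex f x) (preex_ex f y).
Proof.
move=> xy; apply/preex_adjoint; apply: pm_le_trans xy _.
by apply/preex_adjoint/pm_le_refl.
Qed.

Definition fec_fib (A : C) : tMeetSemilatticeType d :=
  prefl (preex_premeet A) d.
Definition fec_reindex (A B : C) (f : hom A B) : fec_fib B -> fec_fib A :=
  prefl_map (preex_reindex f).
Definition fec_ex (A B : C) (f : hom A B) : fec_fib A -> fec_fib B :=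
  prefl_map (preex_ex f).

Lemma fec_reindexE (A B : C) (f : hom A B) (x : preex_premeet B) :
  fec_reindex f (prefl_class x) = prefl_class (preex_reindex f x).
Proof. exact: (prefl_mapE d (preex_reindex_mono f)). Qed.

Lemma fec_exE (A B : C) (f : hom A B) (x : preex_premeet A) :
  fec_ex f (prefl_class x) = prefl_class (preex_ex f x).
Proof. exact: (prefl_mapE d (preex_ex_mono f)). Qed.

Lemma fec_adjoint (A B : C) (f : hom A B) (x : fec_fib A) (y : fec_fib B) :
  (fec_ex f x <= y) = (x <= fec_reindex f y).
Proof.
elim/prefl_ind: x => x; elim/prefl_ind: y => y.
rewrite fec_exE fec_reindexE.
by apply/idP/idP => /prefl_classLE H; apply/prefl_classLE/preex_adjoint.
Qed.

Lemma fec_reindexI (A B : C) (f : hom A B) (x y : fec_fib B) :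
  fec_reindex f (x `&` y) = fec_reindex f x `&` fec_reindex f y.
Proof.
apply/eqP; rewrite eq_le; apply/andP; split.
  by rewrite lexI -!fec_adjoint -lexI fec_adjoint.
by rewrite -fec_adjoint lexI !fec_adjoint -lexI.
Qed.

Lemma fec_reindexT (A B : C) (f : hom A B) : fec_reindex f \top = \top.
Proof. by apply/eqP; rewrite -le1x -fec_adjoint lex1. Qed.

Lemma fec_reindex1 (A : C) (x : fec_fib A) : fec_reindex (idc A) x = x.
Proof.
elim/prefl_ind: x => x; rewrite fec_reindexE; apply/prefl_classP; split.
  exists (pb2 (idc A) (src_map x)) => /=; split=> //.
  by rewrite -pbE comp1c.
by apply/preex_reindex_le; exists (idc _); rewrite comp1c compc1 reindex1.
Qed.

Lemma fec_reindexc (A B D : C) (g : hom B D) (f : hom A B) (x : fec_fib D) :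
  fec_reindex (g ∘ f) x = fec_reindex f (fec_reindex g x).
Proof.
elim/prefl_ind: x => x; rewrite !fec_reindexE; apply/prefl_classP.
have HP y : pm_le y (preex_reindex (g ∘ f) x) <->
    pm_le y (preex_reindex f (preex_reindex g x)).
  rewrite -!preex_adjoint.
  by split=> -[h [/= e l]]; exists h; split=> //=; rewrite -e compA.
by split; apply/HP; apply: pm_le_refl.
Qed.

Definition fec_doctrine : lex_primary_doctrine d C :=
  Doctrine fec_reindexI fec_reindexT fec_reindex1 fec_reindexc.

Lemma fec_beck_chevalley (A B X D : C) (f : hom A X) (g : hom B X)
    (p : hom D A) (q : hom D B) : is_pullback f g p q ->
  forall y : fec_fib B, fec_reindex f (fec_ex g y) = fec_ex p (fec_reindex q y).
Proof.
move=> [e up]; elim/prefl_ind => y; rewrite fec_exE !fec_reindexE fec_exE.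
apply/prefl_classP; split; last first.
  apply/preex_reindex_le; exists (pb2 q (src_map y)) => /=; split=> //.
  by rewrite -compA -pbE !compA e.
have [k [[k1 k2] _]] : exists! h, p ∘ h = pb1 f (g ∘ src_map y) /\
    q ∘ h = src_map y ∘ pb2 f (g ∘ src_map y).
  by apply: up; rewrite pbE compA.
have [m [m1 m2]] := pb_lift k2.
by exists m; rewrite /= -compA m1 k1 -reindexc m2.
Qed.

Lemma fec_frobenius (A B : C) (f : hom A B) (x : fec_fib A) (y : fec_fib B) :
  fec_ex f (x `&` fec_reindex f y) = fec_ex f x `&` y.
Proof.
apply/eqP; rewrite eq_le; apply/andP; split.
  by rewrite fec_adjoint fec_reindexI lexI leIr andbT leIxl // -fec_adjoint.
elim/prefl_ind: x => x; elim/prefl_ind: y => y.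
rewrite fec_exE fec_reindexE !prefl_classI fec_exE; apply/prefl_classLE.
have e : f ∘ (src_map x ∘ pb1 (f ∘ src_map x) (src_map y)) =
    src_map y ∘ pb2 (f ∘ src_map x) (src_map y) by rewrite compA pbE.
have [m [m1 m2]] := pb_lift e.
have [n [n1 n2]] := pb_lift (esym m1).
exists n => /=; rewrite -!compA n1; split=> //.
by rewrite reindexI -!reindexc n1 -m2 n2.
Qed.

Definition full_existential_completion : exdoctrine d C :=
  @ExDoctrine d C fec_doctrine
    (@FullExistential d C fec_doctrine fec_ex fec_adjoint fec_beck_chevalley
      fec_frobenius).

End FullExistentialCompletion.

Section TriposToTopos.
Context {d : Order.disp_t} {C : lexcat} (R : exdoctrine d C).

Record per_object := PerObject {
  per_ob : C;
  per : R (per_ob × per_ob);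
  per_sym : per <= per.[⟨pr2, pr1⟩];
  per_trans : per.[⟨pr31, pr32⟩] `&` per.[⟨pr32, pr33⟩] <= per.[⟨pr31, pr33⟩]
}.

Record functional_relation (a b : per_object)
    (phi : R (per_ob a × per_ob b)) : Prop := FunctionalRelation {
  fr_strict : phi <= (per a).[⟨pr1, pr1⟩] `&` (per b).[⟨pr2, pr2⟩];
  fr_left : (per a).[⟨pr31, pr32⟩] `&` phi.[⟨pr31, pr33⟩] <= phi.[⟨pr32, pr33⟩];
  fr_right : (per b).[⟨pr32, pr33⟩] `&` phi.[⟨pr31, pr32⟩] <= phi.[⟨pr31, pr33⟩];
  fr_single : phi.[⟨pr31, pr32⟩] `&` phi.[⟨pr31, pr33⟩] <= (per b).[⟨pr32, pr33⟩];
  fr_total : (per a).[⟨idc _, idc _⟩] <= exq pr1 phi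
}.

Definition per_hom (a b : per_object) : Type :=
  {phi : R (per_ob a × per_ob b) | functional_relation phi}.

Definition rel_comp {A B D : C} (psi : R (B × D)) (phi : R (A × B)) :
    R (A × D) :=
  exq ⟨pr31, pr33⟩ (phi.[⟨pr31, pr32⟩] `&` psi.[⟨pr32, pr33⟩]).

Lemma per_symE (a : per_object) X (u v : hom X (per_ob a)) :
  (per a).[⟨u, v⟩] <= (per a).[⟨v, u⟩].
Proof.
have := reindex_le ⟨u, v⟩ (per_sym a).
by rewrite sub2 pr1_pair pr2_pair.
Qed.

Lemma pr31_pair (X A B D : C) (u : hom X A) (v : hom X B) (w : hom X D) :
  pr31 ∘ ⟨⟨u, v⟩, w⟩ = u.
Proof. by rewrite /pr31 -compA !pr1_pair. Qed.

Lemma pr32_pair (X A B D : C) (u : hom X A) (v : hom X B) (w : hom X D) :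
  pr32 ∘ ⟨⟨u, v⟩, w⟩ = v.
Proof. by rewrite /pr32 -compA pr1_pair pr2_pair. Qed.

Lemma pr33_pair (X A B D : C) (u : hom X A) (v : hom X B) (w : hom X D) :
  pr33 ∘ ⟨⟨u, v⟩, w⟩ = w.
Proof. exact: pr2_pair. Qed.

Lemma per_transE (a : per_object) X (u v w : hom X (per_ob a)) :
  (per a).[⟨u, v⟩] `&` (per a).[⟨v, w⟩] <= (per a).[⟨u, w⟩].
Proof.
have := reindex_le ⟨⟨u, v⟩, w⟩ (per_trans a).
by rewrite reindexI !sub2 pr31_pair pr32_pair pr33_pair.
Qed.

Section Generalized.
Variables (a b : per_object) (phi : R (per_ob a × per_ob b)).
Hypothesis fphi : functional_relation phi.
Variable X : C.

Lemma fr_strict1E (u : hom X (per_ob a)) (v : hom X (per_ob b)) :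
  phi.[⟨u, v⟩] <= (per a).[⟨u, u⟩].
Proof.
have := reindex_le ⟨u, v⟩ (fr_strict fphi).
by rewrite reindexI !sub2 pr1_pair pr2_pair lexI => /andP[].
Qed.

Lemma fr_strict2E (u : hom X (per_ob a)) (v : hom X (per_ob b)) :
  phi.[⟨u, v⟩] <= (per b).[⟨v, v⟩].
Proof.
have := reindex_le ⟨u, v⟩ (fr_strict fphi).
by rewrite reindexI !sub2 pr1_pair pr2_pair lexI => /andP[].
Qed.

Lemma fr_leftE (u u' : hom X (per_ob a)) (v : hom X (per_ob b)) :
  (per a).[⟨u, u'⟩] `&` phi.[⟨u, v⟩] <= phi.[⟨u', v⟩].
Proof.
have := reindex_le ⟨⟨u, u'⟩, v⟩ (fr_left fphi).
by rewrite reindexI !sub2 pr31_pair pr32_pair pr33_pair.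
Qed.

Lemma fr_rightE (u : hom X (per_ob a)) (v v' : hom X (per_ob b)) :
  (per b).[⟨v, v'⟩] `&` phi.[⟨u, v⟩] <= phi.[⟨u, v'⟩].
Proof.
have := reindex_le ⟨⟨u, v⟩, v'⟩ (fr_right fphi).
by rewrite reindexI !sub2 pr31_pair pr32_pair pr33_pair.
Qed.

Lemma fr_singleE (u : hom X (per_ob a)) (v v' : hom X (per_ob b)) :
  phi.[⟨u, v⟩] `&` phi.[⟨u, v'⟩] <= (per b).[⟨v, v'⟩].
Proof.
have := reindex_le ⟨⟨u, v⟩, v'⟩ (fr_single fphi).
by rewrite reindexI !sub2 pr31_pair pr32_pair pr33_pair.
Qed.

Lemma ex_elim (A B : C) (q : hom A B) (x : R A) (y z : R B) :
  y.[q] `&` x <= z.[q] -> y `&` exq q x <= z.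
Proof. by move=> H; rewrite meetC -frobenius exq_adjoint meetC. Qed.

Lemma pullback_pr (A B : C) (u : hom X A) :
  is_pullback u (@pr1 C A B) (@pr1 C X B) ⟨u ∘ pr1, pr2⟩.
Proof.
split=> [|Y s t e]; first by rewrite pr1_pair.
exists ⟨s, pr2 ∘ t⟩; split.
  rewrite pr1_pair pairc_comp -compA pr1_pair pr2_pair; split=> //.
  by apply: prodc_ext; rewrite ?pr1_pair ?pr2_pair.
move=> k [<- <-]; apply: prodc_ext; rewrite ?pr1_pair ?pr2_pair //.
by rewrite compA pr2_pair.
Qed.

Lemma fr_total_elim (u : hom X (per_ob a)) (y z : R X) :
  y <= (per a).[⟨u, u⟩] ->
  y.[pr1] `&` phi.[⟨u ∘ pr1, pr2⟩] <= z.[pr1] -> y <= z.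
Proof.
move=> yu H; have yE : y <= (exq pr1 phi).[u].
  have := reindex_le u (fr_total fphi).
  by rewrite sub2 comp1c; apply: le_trans.
have /meet_idPl <- := yE.
by rewrite (beck_chevalley (pullback_pr _ u)); apply: ex_elim.
Qed.

End Generalized.

Lemma rel_comp_intro (A B D : C) (psi : R (B × D)) (phi : R (A × B)) X
    (u : hom X A) (v : hom X B) (w : hom X D) :
  phi.[⟨u, v⟩] `&` psi.[⟨v, w⟩] <= (rel_comp psi phi).[⟨u, w⟩].
Proof.
have : phi.[⟨pr31, pr32⟩] `&` psi.[⟨pr32, pr33⟩] <=
    (rel_comp psi phi).[⟨pr31, pr33⟩] by rewrite -exq_adjoint.
move=> /(reindex_le ⟨⟨u, v⟩, w⟩).
by rewrite reindexI !sub2 pr31_pair pr32_pair pr33_pair.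
Qed.

Lemma pullback_pr13 (A B D X : C) (u : hom X A) (w : hom X D) :
  is_pullback ⟨u, w⟩ ⟨@pr31 C A B D, pr33⟩ (@pr1 C X B)
    ⟨⟨u ∘ pr1, pr2⟩, w ∘ pr1⟩.
Proof.
split=> [|Y s t e].
  by rewrite !pairc_comp pr31_pair pr33_pair.
have e1 : u ∘ s = pr31 ∘ t.
  by have := congr1 (fun k => pr1 ∘ k) e; rewrite /= !pairc_comp !pr1_pair.
have e3 : w ∘ s = pr33 ∘ t.
  by have := congr1 (fun k => pr2 ∘ k) e; rewrite /= !pairc_comp !pr2_pair.
exists ⟨s, pr32 ∘ t⟩; split.
  rewrite pr1_pair; split=> //.
  rewrite !pairc_comp -!compA pr1_pair pr2_pair e1 e3 /pr31 /pr32 /pr33.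
  by apply: prodc_ext; rewrite ?pr1_pair ?pr2_pair //;
     apply: prodc_ext; rewrite ?pr1_pair ?pr2_pair !compA.
move=> k [<- <-]; apply: prodc_ext; rewrite ?pr1_pair ?pr2_pair //.
by rewrite compA pr32_pair.
Qed.

Lemma rel_comp_elim (A B D : C) (psi : R (B × D)) (phi : R (A × B)) X
    (u : hom X A) (w : hom X D) (y z : R X) :
  y.[pr1] `&` (phi.[⟨u ∘ pr1, pr2⟩] `&` psi.[⟨pr2, w ∘ pr1⟩]) <= z.[pr1] ->
  y `&` (rel_comp psi phi).[⟨u, w⟩] <= z.
Proof.
move=> H; rewrite (beck_chevalley (pullback_pr13 B u w)); apply: ex_elim.
by rewrite reindexI !sub2 pr31_pair pr32_pair pr33_pair.
Qed.

Lemma rel_comp_elimT (A B D : C) (psi : R (B × D)) (phi : R (A × B)) (z : R (A × D)) :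
  phi.[⟨pr1 ∘ pr1, pr2⟩] `&` psi.[⟨pr2, pr2 ∘ pr1⟩] <= z.[pr1] ->
  rel_comp psi phi <= z.
Proof.
move=> H; rewrite [rel_comp _ _]sub2_id -(meet1x (_.[_])).
by apply: rel_comp_elim; rewrite reindexT meet1x.
Qed.

Lemma per_hom_id_subproof (a : per_object) : functional_relation (per a).
Proof.
have trans := @per_transE a; have sym := @per_symE a.
split.
- rewrite [leLHS]sub2_id lexI; apply/andP; split.
    by apply: le_trans (trans _ _ pr2 _); rewrite lexI lexx sym.
  by apply: le_trans (trans _ _ pr1 _); rewrite lexI lexx sym.
- by apply: le_trans (trans _ _ pr31 _); rewrite leI2 // sym.
- by rewrite meetC trans.
- by apply: le_trans (trans _ _ pr31 _); rewrite leI2 // sym.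
- have H : (per a).[⟨idc _, idc _⟩] <=
      ((exq pr1 (per a)).[pr1]).[⟨idc (per_ob a), idc (per_ob a)⟩].
    by apply: reindex_le; rewrite -exq_adjoint.
  by rewrite -reindexc pr1_pair reindex1 in H.
Qed.

Lemma rel_comp_functional (a b c : per_object)
    (psi : R (per_ob b × per_ob c)) (phi : R (per_ob a × per_ob b)) :
  functional_relation psi -> functional_relation phi ->
  functional_relation (rel_comp psi phi : R (per_ob a × per_ob c)).
Proof.
move=> fpsi fphi; split.
- apply: rel_comp_elimT; rewrite reindexI !sub2 leI2 //.
    exact: (fr_strict1E fphi).
  exact: (fr_strict2E fpsi).
- apply: rel_comp_elim; rewrite !sub2.
  apply: le_trans (rel_comp_intro _ _ _ pr2 _); rewrite lexI.
  apply/andP; split; last by meets.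
  by apply: le_trans (fr_leftE fphi (pr31 ∘ pr1) _ _); meets.
- apply: rel_comp_elim; rewrite !sub2.
  apply: le_trans (rel_comp_intro _ _ _ pr2 _); rewrite lexI.
  apply/andP; split; first by meets.
  by apply: le_trans (fr_rightE fpsi _ (pr32 ∘ pr1) _); meets.
- apply: rel_comp_elim; rewrite !sub2 meetC; apply: rel_comp_elim.
  rewrite !reindexI !sub2.
  set v := pr2 ∘ pr1; set v' := pr2.
  apply: le_trans (fr_singleE fpsi v' _ _); rewrite lexI.
  apply/andP; split; first by meets.
  apply: le_trans (fr_leftE fpsi v _ _); rewrite lexI.
  apply/andP; split; last by meets.
  by apply: le_trans (fr_singleE fphi (pr31 ∘ pr1 ∘ pr1) _ _); meets.
- apply: (fr_total_elim fphi (u := idc _)) => //.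
  rewrite sub2 !comp1c.
  apply: (fr_total_elim fpsi (u := pr2)).
    by apply: leIxr; apply: (fr_strict2E fphi).
  rewrite reindexI !sub2 -reindexc.
  have H : (rel_comp psi phi).[⟨@pr1 _ (per_ob a) (per_ob b) ∘ pr1, pr2⟩] <=
      (exq pr1 (rel_comp psi phi : R (per_ob a × per_ob c))).[pr1 ∘ @pr1 _ _ (per_ob c)].
    have : rel_comp psi phi <= (exq pr1 (rel_comp psi phi : R (per_ob a × per_ob c))).[pr1].
      by rewrite -exq_adjoint.
    move=> /(reindex_le ⟨@pr1 _ (per_ob a) (per_ob b) ∘ pr1, pr2⟩).
    by rewrite -reindexc pr1_pair.
  apply: le_trans H; apply: le_trans (rel_comp_intro _ _ _ (pr2 ∘ pr1) _).
  by meets.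
Qed.

Definition per_id (a : per_object) : per_hom a a :=
  exist _ (per a) (per_hom_id_subproof a).

Definition per_comp (a b c : per_object) (psi : per_hom b c) (phi : per_hom a b) :
    per_hom a c :=
  exist _ _ (rel_comp_functional (svalP psi) (svalP phi)).

Lemma per_hom_ext (a b : per_object) (f g : per_hom a b) :
  sval f = sval g -> f = g.
Proof. by case: f g => [f pf] [g pg] /= e; apply: eq_exist. Qed.

Lemma rel_compA (A B D E : C) (chi : R (D × E)) (psi : R (B × D)) (phi : R (A × B)) :
  rel_comp chi (rel_comp psi phi) = rel_comp (rel_comp chi psi) phi.
Proof.
apply/eqP; rewrite eq_le; apply/andP; split; apply: rel_comp_elimT.
- rewrite meetC; apply: rel_comp_elim; rewrite !sub2 -reindexc.
  rewrite [rel_comp _ _]sub2_id sub2.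
  apply: le_trans (rel_comp_intro _ _ _ pr2 _).
  rewrite !compA lexI; apply/andP; split; first by meets.
  by apply: le_trans (rel_comp_intro _ _ _ (pr2 ∘ pr1) _); meets.
- apply: rel_comp_elim; rewrite !sub2 -reindexc.
  rewrite [rel_comp _ (rel_comp _ _)]sub2_id sub2.
  apply: le_trans (rel_comp_intro _ _ _ pr2 _).
  rewrite !compA lexI; apply/andP; split; last by meets.
  by apply: le_trans (rel_comp_intro _ _ _ (pr2 ∘ pr1) _); meets.
Qed.

Lemma per_compA (a b c e : per_object) (h : per_hom c e) (g : per_hom b c)
    (f : per_hom a b) : per_comp h (per_comp g f) = per_comp (per_comp h g) f.
Proof. by apply: per_hom_ext; apply: rel_compA. Qed.

Lemma per_comp1c (a b : per_object) (f : per_hom a b) :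
  per_comp (per_id b) f = f.
Proof.
apply: per_hom_ext; case: f => phi fphi /=.
apply/eqP; rewrite eq_le; apply/andP; split.
  apply: rel_comp_elimT; rewrite [X in X.[pr1]]sub2_id sub2.
  by rewrite meetC; apply: fr_rightE.
rewrite [leLHS]sub2_id [leRHS]sub2_id.
apply: le_trans (rel_comp_intro _ _ _ pr2 _).
by rewrite lexI lexx; apply: fr_strict2E.
Qed.

Lemma per_compc1 (a b : per_object) (f : per_hom a b) :
  per_comp f (per_id a) = f.
Proof.
apply: per_hom_ext; case: f => phi fphi /=.
apply/eqP; rewrite eq_le; apply/andP; split.
  apply: rel_comp_elimT; rewrite [X in X.[pr1]]sub2_id sub2.
  apply: le_trans (fr_leftE fphi pr2 _ _).
  by rewrite leI2 // per_symE.
rewrite [leLHS]sub2_id [leRHS]sub2_id.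
apply: le_trans (rel_comp_intro _ _ _ pr1 _).
by rewrite lexI lexx andbT; apply: fr_strict1E.
Qed.

Definition tripos_to_topos : category :=
  Category per_compA per_comp1c per_compc1.

End TriposToTopos.

(* The free exact category D_ex/lex, in the explicit form of Carboni and      *)
(* Celia Magno.  The two legs of a pseudo-equivalence relation need not be    *)
(* jointly monic; an arrow is a class of maps compatible with the relations,  *)
(* two maps being identified when they are related by the target relation.    *)

Section ExactCompletion.
Variable D : lexcat.

Record pseudo_equivalence := PseudoEquivalence {
  pe_ob : D;
  pe_rel : D;
  pe1 : hom pe_rel pe_ob;
  pe2 : hom pe_rel pe_ob;
  pe_refl : exists r : hom pe_ob pe_rel, pe1 ∘ r = idc _ /\ pe2 ∘ r = idc _;
  pe_sym : exists s : hom pe_rel pe_rel, pe1 ∘ s = pe2 /\ pe2 ∘ s = pe1;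
  pe_trans : exists t : hom (pb pe2 pe1) pe_rel,
    pe1 ∘ t = pe1 ∘ pb1 pe2 pe1 /\ pe2 ∘ t = pe2 ∘ pb2 pe2 pe1
}.

Definition pe_compatible (E F : pseudo_equivalence)
    (f : hom (pe_ob E) (pe_ob F)) : Prop :=
  exists g : hom (pe_rel E) (pe_rel F),
    pe1 F ∘ g = f ∘ pe1 E /\ pe2 F ∘ g = f ∘ pe2 E.

Definition pe_map (E F : pseudo_equivalence) : Type :=
  {f : hom (pe_ob E) (pe_ob F) | pe_compatible f}.

Definition pe_homotopic (E F : pseudo_equivalence)
    (f f' : {classic pe_map E F}) : bool :=
  `[< exists h : hom (pe_ob E) (pe_rel F),
        pe1 F ∘ h = sval f /\ pe2 F ∘ h = sval f' >].

Lemma pe_homotopic_refl E F : reflexive (@pe_homotopic E F).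
Proof.
move=> f; apply/asboolP; have [r [r1 r2]] := pe_refl F.
by exists (r ∘ sval f); rewrite !compA r1 r2 comp1c.
Qed.

Lemma pe_homotopic_sym E F : symmetric (@pe_homotopic E F).
Proof.
have [s [s1 s2]] := pe_sym F.
by move=> f g; apply/asboolP/asboolP => -[h [h1 h2]];
   exists (s ∘ h); rewrite !compA s1 s2.
Qed.

Lemma pe_homotopic_trans E F : transitive (@pe_homotopic E F).
Proof.
have [t [t1 t2]] := pe_trans F.
move=> g f k /asboolP[h [h1 h2]] /asboolP[h' [h'1 h'2]]; apply/asboolP.
have [m [m1 m2]] := pb_lift (etrans h2 (esym h'1)).
by exists (t ∘ m); rewrite !compA t1 t2 -!compA m1 m2.
Qed.

Canonical pe_homotopic_equiv E F := EquivRel (@pe_homotopic E F)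
  (@pe_homotopic_refl E F) (@pe_homotopic_sym E F) (@pe_homotopic_trans E F).

Definition pe_hom (E F : pseudo_equivalence) : Type :=
  {eq_quot (pe_homotopic_equiv E F)}.

Definition pe_class (E F : pseudo_equivalence) (f : pe_map E F) : pe_hom E F :=
  \pi_({eq_quot (pe_homotopic_equiv E F)}) (f : {classic pe_map E F}).
Definition pe_repr (E F : pseudo_equivalence) (f : pe_hom E F) : pe_map E F :=
  repr (f : {eq_quot (pe_homotopic_equiv E F)}).

Lemma pe_reprK E F (f : pe_hom E F) : pe_class (pe_repr f) = f.
Proof. exact: (@reprK _ {eq_quot (pe_homotopic_equiv E F)}). Qed.

Lemma pe_ind E F (S : pe_hom E F -> Prop) :
  (forall f, S (pe_class f)) -> forall f, S f.
Proof. by move=> H f; rewrite -(pe_reprK f). Qed.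

Lemma pe_classP E F (f g : pe_map E F) :
  pe_class f = pe_class g <-> exists h : hom (pe_ob E) (pe_rel F),
    pe1 F ∘ h = sval f /\ pe2 F ∘ h = sval g.
Proof.
split=> [/eqP|H]; last by apply/eqP; rewrite eqmodE; apply/asboolP.
by rewrite eqmodE => /asboolP.
Qed.

Lemma pe_id_compatible E : pe_compatible (idc (pe_ob E) : hom (pe_ob E) (pe_ob E)).
Proof. by exists (idc _); rewrite !comp1c !compc1. Qed.

Lemma pe_comp_compatible E F G (g : pe_map F G) (f : pe_map E F) :
  pe_compatible (sval g ∘ sval f : hom (pe_ob E) (pe_ob G)).
Proof.
have [k [k1 k2]] := svalP g; have [h [h1 h2]] := svalP f.
by exists (k ∘ h); rewrite !compA k1 k2 -!compA h1 h2.
Qed.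

Definition pe_map_id E : pe_map E E := exist _ _ (pe_id_compatible E).
Definition pe_map_comp E F G (g : pe_map F G) (f : pe_map E F) : pe_map E G :=
  exist _ _ (pe_comp_compatible g f).

Definition pe_id E : pe_hom E E := pe_class (pe_map_id E).
Definition pe_comp E F G (g : pe_hom F G) (f : pe_hom E F) : pe_hom E G :=
  pe_class (pe_map_comp (pe_repr g) (pe_repr f)).

Lemma pe_compE E F G (g : pe_map F G) (f : pe_map E F) :
  pe_comp (pe_class g) (pe_class f) = pe_class (pe_map_comp g f).
Proof.
apply: etrans (_ : pe_class (pe_map_comp g (pe_repr (pe_class f))) = _).
  have /pe_classP[h [h1 h2]] := pe_reprK (pe_class g).
  by apply/pe_classP; exists (h ∘ sval (pe_repr (pe_class f)));
     rewrite !compA h1 h2.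
have /pe_classP[h [h1 h2]] := pe_reprK (pe_class f).
have [k [k1 k2]] := svalP g.
by apply/pe_classP; exists (k ∘ h); rewrite !compA k1 k2 -!compA h1 h2.
Qed.

Lemma pe_class_eq E F (f g : pe_map E F) :
  sval f = sval g -> pe_class f = pe_class g.
Proof.
move=> e; apply/pe_classP; have [r [r1 r2]] := pe_refl F.
by exists (r ∘ sval f); rewrite !compA r1 r2 comp1c.
Qed.

Lemma pe_compA E F G H (h : pe_hom G H) (g : pe_hom F G) (f : pe_hom E F) :
  pe_comp h (pe_comp g f) = pe_comp (pe_comp h g) f.
Proof.
elim/pe_ind: h => h; elim/pe_ind: g => g; elim/pe_ind: f => f.
by rewrite !pe_compE; apply: pe_class_eq; rewrite /= compA.
Qed.

Lemma pe_comp1c E F (f : pe_hom E F) : pe_comp (pe_id F) f = f.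
Proof.
elim/pe_ind: f => f; rewrite /pe_id pe_compE.
by apply: pe_class_eq; rewrite /= comp1c.
Qed.

Lemma pe_compc1 E F (f : pe_hom E F) : pe_comp f (pe_id E) = f.
Proof.
elim/pe_ind: f => f; rewrite /pe_id pe_compE.
by apply: pe_class_eq; rewrite /= compc1.
Qed.

Definition exact_completion : category := Category pe_compA pe_comp1c pe_compc1.

End ExactCompletion.

(* Main.v *)
(** An element of the completed fibre over X is the class of a pair (f, α), that
is, of a map f from a point (B, α) of P to X.  Every element is thus determined
by the generalized elements below it, with stages in the category of points, and
on these both conjunction and existential quantification are evaluated
pointwise: a generalized element of ∃_g x lifts along g to one of x at the same
stage.  A pseudo-equivalence relation in the category of points therefore has as
image a partial equivalence relation, and this gives a functor from the exact
completion.  It is full because totality of a functional relation, taken at the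
generic element of its source, provides an actual arrow; it is faithful because
two maps with the same graph are related by a homotopy; it is essentially
surjective because the extent of a partial equivalence relation ρ on A is
presented by a point (D, δ) with a map D -> A, along which ρ pulls back to a
pseudo-equivalence relation on (D, δ). *)

From mathcomp Require Import all_boot all_order boolp.
Require Import Defs.

Set Implicit Arguments.
Unset Strict Implicit.
Unset Printing Implicit Defensive.

Import Order.TTheory.

Local Open Scope order_scope.
Local Open Scope cat_scope.

(** * Fully faithful and essentially surjective functors *)

Section FullyFaithfulEssentiallySurjective.
Variables (C D : category) (F : functor C D).
Hypothesis full : forall (A B : C) (g : hom (F A) (F B)), exists f : hom A B, fhom F f = g.
Hypothesis faithful : forall (A B : C) (f g : hom A B), fhom F f = fhom F g -> f = g.
Hypothesis surj : forall Y : D, exists (A : C) (f : hom (F A) Y), is_iso f.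

(** The quasi-inverse is built by choice: [cid] picks a preimage and an isomorphism, by which arrows
    are conjugated before being lifted through fullness. *)
Let G0 (Y : D) : C := sval (cid (surj Y)).
Let e (Y : D) : hom (F (G0 Y)) Y := sval (cid (svalP (cid (surj Y)))).
Let e_iso (Y : D) : is_iso (e Y) := svalP (cid (svalP (cid (surj Y)))).
Let i (Y : D) : hom Y (F (G0 Y)) := sval (cid (e_iso Y)).

Let ie Y : i Y ∘ e Y = idc _.
Proof. by case: (svalP (cid (e_iso Y))). Qed.

Let ei Y : e Y ∘ i Y = idc _.
Proof. by case: (svalP (cid (e_iso Y))). Qed.

Let lift (A B : C) (g : hom (F A) (F B)) : hom A B := sval (cid (full g)).

Let liftK (A B : C) (g : hom (F A) (F B)) : fhom F (lift g) = g.
Proof. exact: svalP (cid (full g)). Qed.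

Let lift_iso (A B : C) (g : hom (F A) (F B)) (h : hom (F B) (F A)) :
  h ∘ g = idc _ -> g ∘ h = idc _ -> is_iso (lift g).
Proof.
by move=> hg gh; exists (lift h); split; apply: faithful;
   rewrite fhomc !liftK fhom1.
Qed.

Let G1 (Y Z : D) (f : hom Y Z) : hom (G0 Y) (G0 Z) := lift (i Z ∘ f ∘ e Y).

Let G1_id Y : G1 (idc Y) = idc (G0 Y).
Proof. by apply: faithful; rewrite liftK compc1 ie fhom1. Qed.

Let G1_comp X Y Z (g : hom Y Z) (f : hom X Y) : G1 (g ∘ f) = G1 g ∘ G1 f.
Proof.
apply: faithful; rewrite fhomc !liftK !compA.
by rewrite -(compA _ (e Y) (i Y)) ei compc1.
Qed.

Lemma fully_faithful_ess_surj_equivalence : equivalent_categories D C.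
Proof.
exists (Functor G1_id G1_comp), F; split; last first.
  exists (fun A => lift (e (F A))); split=> [A|A B f] /=.
    exact: lift_iso (ie _) (ei _).
  by apply: faithful; rewrite !fhomc !liftK !compA ei comp1c.
exists e; split=> [Y|Y Z f] /=; first exact: e_iso.
by rewrite liftK !compA ei comp1c.
Qed.

End FullyFaithfulEssentiallySurjective.

(** * Generalized elements in the full existential completion *)

Section Forcing.
Context {d : Order.disp_t} {C : lexcat} {P : lex_primary_doctrine d C}.
Local Notation R := (full_existential_completion P).
Local Notation G := (points P).
Implicit Types (X Y A B D : C) (y z : G).

(* [gen f <= x] reads: [f] is a generalized element of [x] at stage [y]. *)
Definition gen X y (f : hom (pt_ob y) X) : R X :=
  prefl_class (PreEx f (pt_pred y) : preex_premeet P X).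

Lemma gen_exq X Y y (g : hom X Y) (f : hom (pt_ob y) X) :
  exq g (gen f) = gen (g ∘ f).
Proof. exact: fec_exE. Qed.

Lemma gen_reindex X Y y (g : hom X Y) (f : hom (pt_ob y) X) (x : R Y) :
  (gen f <= x.[g]) = (gen (g ∘ f) <= x).
Proof. by rewrite -gen_exq exq_adjoint. Qed.

Lemma gen_surj X (x : R X) : exists (y : G) (f : hom (pt_ob y) X), x = gen f.
Proof.
elim/prefl_ind: x => x.
by exists (Point (src_pred x)), (src_map x); case: x.
Qed.

(** The inequality required of a factorization in the completion is exactly what makes it an arrow
    of the category of points. *)
Lemma gen_le_gen X y z (f : hom (pt_ob y) X) (g : hom (pt_ob z) X) :
  gen f <= gen g <-> exists k : hom y z, f = g ∘ sval k.
Proof.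
split=> [/prefl_classLE [/= h [e l]]|[k e]]; first by exists (pt_mk l).
by apply/prefl_classLE; exists (sval k); split=> //; apply: svalP k.
Qed.

Lemma gen_precomp X y z (f : hom (pt_ob y) X) (k : hom z y) (x : R X) :
  gen f <= x -> gen (f ∘ sval k : hom (pt_ob z) X) <= x.
Proof. by apply: le_trans; apply/gen_le_gen; exists k. Qed.

Lemma gen_le X (x x' : R X) :
  (forall y (f : hom (pt_ob y) X), gen f <= x -> gen f <= x') -> x <= x'.
Proof. by move=> H; have [y [f e]] := gen_surj x; rewrite e H // e. Qed.

(** Writing [x] as [gen m] turns [exq g x] into [gen (g ∘ m)], so the witness is found at the same
    stage, without passing to a cover. *)
Lemma gen_le_exq X Y y (g : hom X Y) (f : hom (pt_ob y) Y) (x : R X) :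
  gen f <= exq g x <-> exists h : hom (pt_ob y) X, f = g ∘ h /\ gen h <= x.
Proof.
have [z [m ->]] := gen_surj x; rewrite gen_exq; split.
  move=> /gen_le_gen[k ->]; exists (m ∘ sval k); rewrite compA; split=> //.
  exact: gen_precomp.
move=> [h [-> /gen_le_gen[k ->]]]; rewrite compA.
exact: gen_precomp.
Qed.

(** Evaluates an inequality over [pt_ob y] at the generic element [idc (pt_ob y)]; laws such as
    [per_symE] thus become statements about [rel]. *)
Lemma gen_reindex_mono Y Y' y (g : hom (pt_ob y) Y) (g' : hom (pt_ob y) Y')
    (x : R Y) (x' : R Y') :
  x.[g] <= x'.[g'] -> gen g <= x -> gen g' <= x'.
Proof.
move=> l; rewrite -(compc1 g) -(compc1 g') -!gen_reindex => /le_trans; exact.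
Qed.

Lemma gen_reindex_mono2 Y1 Y2 Y y (g1 : hom (pt_ob y) Y1)
    (g2 : hom (pt_ob y) Y2) (g : hom (pt_ob y) Y) (x1 : R Y1) (x2 : R Y2) (x : R Y) :
  x1.[g1] `&` x2.[g2] <= x.[g] -> gen g1 <= x1 -> gen g2 <= x2 -> gen g <= x.
Proof.
move=> l; rewrite -(compc1 g1) -(compc1 g2) -(compc1 g) -!gen_reindex => l1 l2.
by apply: le_trans l; rewrite lexI l1 l2.
Qed.

(** Forcing in the style of Kripke and Joyal: [phi] holds of [(u, v)] at stage [y]. *)
Definition rel y A B (phi : R (A × B)) (u : hom (pt_ob y) A)
  (v : hom (pt_ob y) B) : bool := gen ⟨u, v⟩ <= phi.

Lemma pairc_eta Y A B (f : hom Y (A × B)) : f = ⟨pr1 ∘ f, pr2 ∘ f⟩.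
Proof. by rewrite -pairc_comp pairc_pr comp1c. Qed.

Lemma pairc_inj Y A B (f f' : hom Y A) (g g' : hom Y B) :
  ⟨f, g⟩ = ⟨f', g'⟩ -> f = f' /\ g = g'.
Proof.
by move=> e; rewrite -(pr1_pair f g) -{2}(pr2_pair f g) e pr1_pair pr2_pair.
Qed.

Lemma rel_le A B (phi psi : R (A × B)) :
  (forall y (u : hom (pt_ob y) A) (v : hom (pt_ob y) B), rel phi u v -> rel psi u v) ->
  phi <= psi.
Proof. by move=> H; apply: gen_le => y f; rewrite (pairc_eta f); apply: H. Qed.

Lemma rel_ext A B (phi psi : R (A × B)) :
  (forall y (u : hom (pt_ob y) A) (v : hom (pt_ob y) B), rel phi u v <-> rel psi u v) ->
  phi = psi.
Proof.
by move=> H; apply: le_anti; apply/andP; split; apply: rel_le => y u v /H.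
Qed.

Lemma rel_reindex y X A B (phi : R (A × B)) (f : hom X A) (g : hom X B)
    (h : hom (pt_ob y) X) :
  (gen h <= phi.[⟨f, g⟩]) = rel phi (f ∘ h) (g ∘ h).
Proof. by rewrite gen_reindex pairc_comp. Qed.

Lemma rel_gen y z A B (f : hom (pt_ob z) A) (g : hom (pt_ob z) B)
    (u : hom (pt_ob y) A) (v : hom (pt_ob y) B) :
  rel (gen ⟨f, g⟩) u v <-> exists k : hom y z, u = f ∘ sval k /\ v = g ∘ sval k.
Proof.
split=> [/gen_le_gen[k]|[k [-> ->]]].
  by rewrite pairc_comp => /pairc_inj[-> ->]; exists k.
by apply/gen_le_gen; exists k; rewrite pairc_comp.
Qed.

Lemma rel_precomp y z A B (phi : R (A × B)) (u : hom (pt_ob y) A)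
    (v : hom (pt_ob y) B) (k : hom z y) :
  rel phi u v -> rel phi (u ∘ sval k : hom (pt_ob z) A) (v ∘ sval k).
Proof. by move=> /(gen_precomp k); rewrite pairc_comp. Qed.

Lemma rel_rel_comp y A B D (psi : R (B × D)) (phi : R (A × B))
    (u : hom (pt_ob y) A) (w : hom (pt_ob y) D) :
  rel (rel_comp psi phi) u w <->
  exists v : hom (pt_ob y) B, rel phi u v /\ rel psi v w.
Proof.
split=> [/gen_le_exq[h []]|[v [phiuv psivw]]].
  rewrite pairc_comp lexI !rel_reindex => /pairc_inj[-> ->] /andP[H1 H2].
  by exists (pr32 ∘ h).
apply/gen_le_exq; exists ⟨⟨u, v⟩, w⟩; rewrite pairc_comp pr31_pair pr33_pair.
by rewrite lexI !rel_reindex pr31_pair pr32_pair pr33_pair phiuv psivw.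
Qed.

(** * Partial equivalence relations and functional relations, evaluated at stages *)

Section Per.
Variables (A : C) (rho : R (A × A)).
Hypothesis rho_sym : forall y (u v : hom (pt_ob y) A), rel rho u v -> rel rho v u.
Hypothesis rho_trans : forall y (u v w : hom (pt_ob y) A),
  rel rho u v -> rel rho v w -> rel rho u w.

Lemma per_of_sym : rho <= rho.[⟨pr2, pr1⟩].
Proof.
by apply: gen_le => y f; rewrite {1}(pairc_eta f) rel_reindex; apply: rho_sym.
Qed.

Lemma per_of_trans :
  rho.[⟨pr31, pr32⟩] `&` rho.[⟨pr32, pr33⟩] <= rho.[⟨pr31, pr33⟩].
Proof.
apply: gen_le => y f; rewrite lexI !rel_reindex => /andP[].
exact: rho_trans.
Qed.

Definition per_of : per_object R := PerObject per_of_sym per_of_trans.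
End Per.

Section PerObject.
Variables (a : per_object R) (y : G).
Implicit Types u v w : hom (pt_ob y) (per_ob a).

Lemma rel_per_sym u v : rel (per a) u v -> rel (per a) v u.
Proof. exact: gen_reindex_mono (per_symE _ _). Qed.

Lemma rel_per_trans v u w :
  rel (per a) u v -> rel (per a) v w -> rel (per a) u w.
Proof. exact: gen_reindex_mono2 (per_transE _ _ _). Qed.

End PerObject.

Section FunctionalRelation.
Variables (a b : per_object R) (phi : R (per_ob a × per_ob b)).

(** Inequalities are tested on generalized elements. The second condition moves both variables at
    once; strictness supplies the variable to be kept fixed. *)
Lemma functional_of :
  (forall y (u : hom (pt_ob y) (per_ob a)) (v : hom (pt_ob y) (per_ob b)),
    rel phi u v -> rel (per a) u u /\ rel (per b) v v) ->
  (forall y (u u' : hom (pt_ob y) (per_ob a)) (v v' : hom (pt_ob y) (per_ob b)),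
    rel (per a) u u' -> rel (per b) v v' -> rel phi u v -> rel phi u' v') ->
  (forall y (u : hom (pt_ob y) (per_ob a)) (v v' : hom (pt_ob y) (per_ob b)),
    rel phi u v -> rel phi u v' -> rel (per b) v v') ->
  (forall y (u : hom (pt_ob y) (per_ob a)),
    rel (per a) u u -> exists v : hom (pt_ob y) (per_ob b), rel phi u v) ->
  functional_relation phi.
Proof.
move=> strict ext single total; split.
- apply: gen_le => y f; rewrite {1}(pairc_eta f) lexI !rel_reindex.
  by move=> /strict[-> ->].
- apply: gen_le => y f; rewrite lexI !rel_reindex => /andP[H1 H2].
  by apply: (ext _ _ _ _ _ H1 _ H2); case: (strict _ _ _ H2).
- apply: gen_le => y f; rewrite lexI !rel_reindex => /andP[H1 H2].
  by apply: (ext _ _ _ _ _ _ H1 H2); case: (strict _ _ _ H2).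
- apply: gen_le => y f; rewrite lexI !rel_reindex => /andP[]; exact: single.
- apply: gen_le => y f; rewrite rel_reindex !comp1c => /total[v H].
  by apply/gen_le_exq; exists ⟨f, v⟩; rewrite pr1_pair.
Qed.

Hypothesis fphi : functional_relation phi.
Variable y : G.
Implicit Types (u : hom (pt_ob y) (per_ob a)) (v : hom (pt_ob y) (per_ob b)).

Lemma rel_strict u v : rel phi u v -> rel (per a) u u /\ rel (per b) v v.
Proof.
move=> H; split.
  exact: gen_reindex_mono (fr_strict1E fphi _ _) H.
exact: gen_reindex_mono (fr_strict2E fphi _ _) H.
Qed.

Lemma rel_left u u' v : rel (per a) u u' -> rel phi u v -> rel phi u' v.
Proof. exact: gen_reindex_mono2 (fr_leftE fphi _ _ _). Qed.

Lemma rel_right u v v' : rel (per b) v v' -> rel phi u v -> rel phi u v'.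
Proof. exact: gen_reindex_mono2 (fr_rightE fphi _ _ _). Qed.

Lemma rel_single u v v' : rel phi u v -> rel phi u v' -> rel (per b) v v'.
Proof. exact: gen_reindex_mono2 (fr_singleE fphi _ _ _). Qed.

Lemma rel_total u : rel (per a) u u -> exists v, rel phi u v.
Proof.
move=> H; have : gen u <= exq pr1 phi.
  apply: le_trans (fr_total fphi).
  by rewrite rel_reindex comp1c.
move=> /gen_le_exq[h [-> ph]]; exists (pr2 ∘ h).
by rewrite /rel -pairc_eta.
Qed.

End FunctionalRelation.

(** Single-valuedness of [psi] gives one inclusion, totality of [phi] the other. Used in both
    directions, it makes converse functional relations inverse. *)
Lemma rel_comp_converse (a b : per_object R) (phi : R (per_ob a × per_ob b))
    (psi : R (per_ob b × per_ob a)) :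
  functional_relation phi -> functional_relation psi ->
  (forall y (u : hom (pt_ob y) (per_ob a)) (v : hom (pt_ob y) (per_ob b)),
    rel psi v u <-> rel phi u v) ->
  rel_comp psi phi = per a.
Proof.
move=> fphi fpsi conv; apply: rel_ext => y u u'; split=> [/rel_rel_comp|H].
  by move=> [v [/conv H1 H2]]; apply: (rel_single fpsi) H1 H2.
have [v Hv] := rel_total fphi (rel_per_trans H (rel_per_sym H)).
apply/rel_rel_comp; exists v; split=> //; apply/conv.
exact: (rel_left fphi) H Hv.
Qed.

End Forcing.

(** * The image of a pseudo-equivalence relation *)

Section Realization.
Context {d : Order.disp_t} {C : lexcat} (P : lex_primary_doctrine d C).
Local Notation R := (full_existential_completion P).
Local Notation G := (points P).
Local Notation Ex := (exact_completion G).
Local Notation T := (tripos_to_topos R).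
Implicit Types (y z : G) (E F : pseudo_equivalence G).

Definition pe_image E : R (pt_ob (pe_ob E) × pt_ob (pe_ob E)) :=
  gen (y := pe_rel E) ⟨sval (pe1 E), sval (pe2 E)⟩.

Lemma rel_pe_image E y (u v : hom (pt_ob y) (pt_ob (pe_ob E))) :
  rel (pe_image E) u v <->
  exists k : hom y (pe_rel E), u = sval (pe1 E ∘ k) /\ v = sval (pe2 E ∘ k).
Proof. exact: rel_gen. Qed.

Lemma pe_image_sym E y (u v : hom (pt_ob y) (pt_ob (pe_ob E))) :
  rel (pe_image E) u v -> rel (pe_image E) v u.
Proof.
move=> /rel_pe_image[k [-> ->]]; have [s [s1 s2]] := pe_sym E.
by apply/rel_pe_image; exists (s ∘ k); rewrite !compA s1 s2.
Qed.

Lemma pe_image_trans E y (u v w : hom (pt_ob y) (pt_ob (pe_ob E))) :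
  rel (pe_image E) u v -> rel (pe_image E) v w -> rel (pe_image E) u w.
Proof.
move=> /rel_pe_image[k [-> vk]] /rel_pe_image[l [vl ->]].
have [t [t1 t2]] := pe_trans E.
have [m [m1 m2]] : exists m, pb1 (pe2 E) (pe1 E) ∘ m = k /\ pb2 (pe2 E) (pe1 E) ∘ m = l.
  by apply: pb_lift; apply: pt_hom_ext; rewrite -vk -vl.
by apply/rel_pe_image; exists (t ∘ m); rewrite !compA t1 t2 -!compA m1 m2.
Qed.

Definition pe_per E : T := per_of (@pe_image_sym E) (@pe_image_trans E).

(** With [pe_per_dom], this identifies the extent of [pe_per E] with the arrows into [pe_ob E] in
    the category of points; the predicate of [pe_ob E] is remembered in this way. *)
Lemma pe_per_refl E y (k : hom y (pe_ob E)) : rel (per (pe_per E)) (sval k) (sval k).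
Proof.
have [r [r1 r2]] := pe_refl E.
by apply/rel_pe_image; exists (r ∘ k); rewrite !compA r1 r2 comp1c.
Qed.

Lemma pe_per_dom E y (u v : hom (pt_ob y) (pt_ob (pe_ob E))) :
  rel (per (pe_per E)) u v ->
  exists j k : hom y (pe_ob E), u = sval j /\ v = sval k.
Proof. by move=> /rel_pe_image[k [-> ->]]; exists (pe1 E ∘ k), (pe2 E ∘ k). Qed.

Lemma pe_map_per E F (f : pe_map E F) y (j k : hom y (pe_ob E)) :
  rel (per (pe_per E)) (sval j) (sval k) ->
  rel (per (pe_per F)) (sval (sval f ∘ j)) (sval (sval f ∘ k)).
Proof.
move=> /rel_pe_image[l [/pt_hom_ext -> /pt_hom_ext ->]].
have [g [g1 g2]] := svalP f; apply/rel_pe_image; exists (g ∘ l).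
by rewrite !compA g1 g2.
Qed.

(** Composing the strict graph with the target relation closes it under that relation; closure in
    the source variable comes from compatibility of [f]. *)
Definition pe_graph E F (f : pe_map E F) :
    R (per_ob (pe_per E) × per_ob (pe_per F)) :=
  rel_comp (per (pe_per F)) (gen (y := pe_ob E) ⟨idc _, sval (sval f)⟩).

Lemma rel_pe_graph E F (f : pe_map E F) y (u : hom (pt_ob y) (pt_ob (pe_ob E)))
    (v : hom (pt_ob y) (pt_ob (pe_ob F))) :
  rel (pe_graph f) u v <->
  exists k : hom y (pe_ob E), u = sval k /\
    rel (per (pe_per F)) (sval (sval f ∘ k)) v.
Proof.
split=> [/rel_rel_comp[w [/rel_gen[k [-> ->]] H]]|[k [-> H]]].
  by exists k; rewrite comp1c.
apply/rel_rel_comp; exists (sval (sval f ∘ k)); split=> //.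
by apply/rel_gen; exists k; rewrite comp1c.
Qed.

Lemma pe_graph_functional E F (f : pe_map E F) : functional_relation (pe_graph f).
Proof.
apply: functional_of => y.
- move=> u v /rel_pe_graph[k [-> H]]; split; first exact: pe_per_refl.
  exact: rel_per_trans (rel_per_sym H) H.
- move=> u u' v v' Hu Hv /rel_pe_graph[k [eu H]]; rewrite eu in Hu.
  have [j [k' [ej ek]]] := pe_per_dom Hu; apply/rel_pe_graph; exists k'; split=> //.
  apply: rel_per_trans Hv; apply: rel_per_trans H.
  by apply: pe_map_per; rewrite -ek; apply: rel_per_sym.
- move=> u v v' /rel_pe_graph[k [-> H]] /rel_pe_graph[k' [/pt_hom_ext <- H']].
  exact: rel_per_trans (rel_per_sym H) H'.
- move=> u /pe_per_dom[k [_ [-> _]]]; exists (sval (sval f ∘ k)).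
  by apply/rel_pe_graph; exists k; split=> //; apply: pe_per_refl.
Qed.

Lemma pe_graph_homotopic E F (f g : pe_map E F) :
  pe_class f = pe_class g <-> pe_graph f = pe_graph g.
Proof.
split=> [/pe_classP[h [h1 h2]]|e].
  have fg y (k : hom y (pe_ob E)) :
      rel (per (pe_per F)) (sval (sval f ∘ k)) (sval (sval g ∘ k)).
    by apply/rel_pe_image; exists (h ∘ k); rewrite !compA h1 h2.
  apply: rel_ext => y u v; split=> /rel_pe_graph[k [-> H]];
    apply/rel_pe_graph; exists k; split=> //; apply: rel_per_trans H => //.
  exact: rel_per_sym.
(* At the generic element of the source, equality of graphs gives a factorization through
   [pe_rel F], which is the homotopy. *)
have : rel (pe_graph g) (idc (pt_ob (pe_ob E))) (sval (sval g)).
  apply/rel_pe_graph; exists (idc _); split=> //.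
  by rewrite compc1; apply: pe_per_refl.
rewrite -e => /rel_pe_graph[k [ek /rel_pe_image[h [h1 h2]]]].
have {}ek : k = idc _ by apply: pt_hom_ext.
apply/pe_classP; exists h; split; apply: pt_hom_ext => //.
by rewrite -h1 ek compc1.
Qed.

Lemma pe_graph_id E : pe_graph (pe_map_id E) = per (pe_per E).
Proof.
apply: rel_ext => y u v; split=> [/rel_pe_graph[k [->]]|H].
  by rewrite comp1c.
have [k [_ [ek _]]] := pe_per_dom H.
by apply/rel_pe_graph; exists k; rewrite comp1c -ek.
Qed.

Lemma pe_graph_comp E F H (g : pe_map F H) (f : pe_map E F) :
  pe_graph (pe_map_comp g f) = rel_comp (pe_graph g) (pe_graph f).
Proof.
apply: rel_ext => y u w; split.
  move=> /rel_pe_graph[k [-> kw]]; apply/rel_rel_comp.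
  exists (sval (sval f ∘ k)); split; apply/rel_pe_graph.
    by exists k; split=> //; apply: pe_per_refl.
  by exists (sval f ∘ k); rewrite compA.
move=> /rel_rel_comp[v [/rel_pe_graph[k [-> kv]] /rel_pe_graph[l [ev lw]]]].
rewrite ev in kv.
apply/rel_pe_graph; exists k; split=> //; apply: rel_per_trans lw.
by rewrite -compA; apply: pe_map_per.
Qed.

(** * The realization functor, its faithfulness and fullness *)

Definition realize_hom E F (f : pe_hom E F) : per_hom (pe_per E) (pe_per F) :=
  exist _ _ (pe_graph_functional (pe_repr f)).

(** Frees the value from the representative chosen by [pe_repr], since homotopic maps have equal
    graphs. *)
Lemma realize_class E F (f : pe_map E F) :
  realize_hom (pe_class f) = exist _ _ (pe_graph_functional f).
Proof. by apply: per_hom_ext; apply/pe_graph_homotopic/pe_reprK. Qed.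

Lemma realize_id E : realize_hom (pe_id E) = per_id (pe_per E).
Proof. by rewrite realize_class; apply: per_hom_ext; apply: pe_graph_id. Qed.

Lemma realize_comp E F H (g : pe_hom F H) (f : pe_hom E F) :
  realize_hom (pe_comp g f) = per_comp (realize_hom g) (realize_hom f).
Proof.
elim/pe_ind: g => g; elim/pe_ind: f => f; rewrite pe_compE !realize_class.
by apply: per_hom_ext; apply: pe_graph_comp.
Qed.

Definition realize : functor Ex T := @Functor Ex T _ _ realize_id realize_comp.

Lemma realize_faithful E F (f g : @hom Ex E F) :
  fhom realize f = fhom realize g -> f = g.
Proof.
move: f g; elim/pe_ind => f; elim/pe_ind => g /= e; apply/pe_graph_homotopic.
by move: e; rewrite !realize_class => /(congr1 sval).
Qed.

Lemma realize_full E F (phi : @hom T (realize E) (realize F)) :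
  exists f : @hom Ex E F, fhom realize f = phi.
Proof.
have fphi := svalP phi; set A := pe_ob E.
(* Totality at the generic element of [A] yields a value [v]; by strictness, [v] underlies an arrow
   [m] of the category of points. *)
have [v Hv] := rel_total fphi (pe_per_refl (idc A)).
have [_ /pe_per_dom[m [_ [em _]]]] := rel_strict fphi Hv.
have Hm y (k : hom y A) : rel (sval phi) (sval k) (sval (m ∘ k)).
  by have := rel_precomp k Hv; rewrite em comp1c.
(* The legs of [E] are the generic related pair; single-valuedness relates their images under [m],
   and the resulting factorization is the map on relations. *)
have cm : pe_compatible m.
  have : rel (per (pe_per F)) (sval (m ∘ pe1 E)) (sval (m ∘ pe2 E)).
    apply: (rel_single fphi) (Hm _ _).
    apply: (rel_left fphi) (Hm _ _).
    by apply/rel_pe_image; exists (idc _); rewrite !compc1.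
  by move=> /rel_pe_image[g [/pt_hom_ext g1 /pt_hom_ext g2]]; exists g.
exists (pe_class (exist _ m cm)); rewrite /= realize_class.
apply: per_hom_ext; apply: rel_ext => y u w; split=> [/rel_pe_graph[k [-> H]]|H].
  exact: (rel_right fphi H) (Hm _ _).
have [/pe_per_dom[k [_ [ek _]]] _] := rel_strict fphi H.
apply/rel_pe_graph; exists k; split=> //.
by apply: (rel_single fphi) (Hm _ _) _; rewrite -ek.
Qed.

(** * Essential surjectivity *)

Lemma pe_image_surj z (chi : R (pt_ob z × pt_ob z)) :
  (forall y (u v : hom (pt_ob y) (pt_ob z)), rel chi u v ->
    exists j k : hom y z, u = sval j /\ v = sval k) ->
  rel chi (idc (pt_ob z)) (idc (pt_ob z)) ->
  (forall y (u v : hom (pt_ob y) (pt_ob z)), rel chi u v -> rel chi v u) ->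
  (forall y (u v w : hom (pt_ob y) (pt_ob z)),
    rel chi u v -> rel chi v w -> rel chi u w) ->
  exists (r : G) (e1 e2 : hom r z) refl sym trans,
    chi = pe_image (@PseudoEquivalence G z r e1 e2 refl sym trans).
Proof.
move=> dom chi_refl chi_sym chi_trans.
(* The stage [r] of a presentation of [chi] becomes the object of relations; [dom] at the generic
   pair turns both components of [m] into arrows to [z]. *)
have [r [m chiE]] := gen_surj chi; rewrite (pairc_eta m) in chiE.
have chi_gen : rel chi (pr1 ∘ m) (pr2 ∘ m) by rewrite chiE /rel lexx.
have [e1 [e2 [E1 E2]]] := dom _ _ _ chi_gen.
rewrite E1 E2 in chiE chi_gen.
(* Related pairs factor through [r]; the structure maps arise by evaluating the laws of [chi] at
   [z], at [r] and at the pullback of the legs. *)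
have relE y (j k : hom y z) : rel chi (sval j) (sval k) ->
    exists l : hom y r, e1 ∘ l = j /\ e2 ∘ l = k.
  by rewrite chiE => /rel_gen[l [jl kl]]; exists l; split; apply: pt_hom_ext.
have refl : exists s : hom z r, e1 ∘ s = idc _ /\ e2 ∘ s = idc _ by apply: relE.
have sym : exists s : hom r r, e1 ∘ s = e2 /\ e2 ∘ s = e1.
  by apply: relE; apply: chi_sym.
have trans : exists t : hom (pb e2 e1) r,
    e1 ∘ t = e1 ∘ pb1 e2 e1 /\ e2 ∘ t = e2 ∘ pb2 e2 e1.
  apply: relE; apply: (chi_trans _ _ (sval (e2 ∘ pb1 e2 e1))).
    exact: rel_precomp chi_gen.
  by rewrite pbE; apply: rel_precomp chi_gen.
by exists r, e1, e2, refl, sym, trans.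
Qed.

Lemma realize_ess_surj (a : T) :
  exists (E : Ex) (f : hom (realize E) a), is_iso f.
Proof.
(* The point [z], with the map [n] to the carrier, presents the extent of [per a]. *)
have [z [n nE]] := gen_surj ((per a).[⟨idc _, idc _⟩]).
have domP y (u : hom (pt_ob y) (per_ob a)) :
    rel (per a) u u <-> exists k : hom y z, u = n ∘ sval k.
  by rewrite -gen_le_gen -nE rel_reindex comp1c.
(* The saturated graph of [n]; it will be the isomorphism, with its converse [psi'] as inverse. *)
pose psi : R (pt_ob z × per_ob a) :=
  rel_comp (per a) (gen (y := z) ⟨idc _, n⟩).
have psiP y u v : rel (y := y) psi u v <->
    exists k : hom y z, u = sval k /\ rel (per a) (n ∘ sval k) v.
  split=> [/rel_rel_comp[w [/rel_gen[k [-> ->]] H]]|[k [-> H]]].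
    by exists k; rewrite comp1c.
  apply/rel_rel_comp; exists (n ∘ sval k); split=> //.
  by apply/rel_gen; exists k; rewrite comp1c.
pose psi' := psi.[⟨pr2, pr1⟩].
have conv y u v : rel (y := y) psi' v u <-> rel psi u v.
  by rewrite {1}/rel rel_reindex pr1_pair pr2_pair.
(* This composite is [per a] pulled back along [n] and restricted to arrows into [z]. *)
pose chi := rel_comp psi' psi.
have chiP y u v : rel (y := y) chi u v <-> exists j k : hom y z,
    [/\ u = sval j, v = sval k & rel (per a) (n ∘ sval j) (n ∘ sval k)].
  split=> [/rel_rel_comp[w []]|[j [k [-> -> H]]]].
    move=> /psiP[j [-> jw]] /conv/psiP[k [-> kw]]; exists j, k; split=> //.
    exact: rel_per_trans jw (rel_per_sym kw).
  apply/rel_rel_comp; exists (n ∘ sval k); split; last apply/conv;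
    apply/psiP; [by exists j|exists k; split=> //].
  by apply/domP; exists k.
have [|||| r [e1 [e2 [refl [sym [trans chiE]]]]]] := @pe_image_surj z chi.
- by move=> y u v /chiP[j [k [-> -> _]]]; exists j, k.
- by apply/chiP; exists (idc z), (idc z); split=> //; apply/domP; exists (idc z).
- move=> y u v /chiP[j [k [-> -> H]]]; apply/chiP; exists k, j; split=> //.
  exact: rel_per_sym.
- move=> y u v w /chiP[j [k [-> -> H]]] /chiP[k' [l [/pt_hom_ext <- -> H']]].
  by apply/chiP; exists j, l; split=> //; apply: rel_per_trans H H'.
set E := PseudoEquivalence refl sym trans in chiE.
have perE : per (pe_per E) = chi by rewrite chiE.
have fpsi : @functional_relation _ _ _ (pe_per E) a psi.
  apply: functional_of => y; rewrite ?perE.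
  - move=> u v /psiP[k [-> H]]; split.
      by apply/chiP; exists k, k; split=> //; apply/domP; exists k.
    exact: rel_per_trans (rel_per_sym H) H.
  - move=> u u' v v' /chiP[j [k [-> -> jk]]] vv' /psiP[j' [/pt_hom_ext <- H]].
    apply/psiP; exists k; split=> //; apply: rel_per_trans vv'.
    exact: rel_per_trans (rel_per_sym jk) H.
  - move=> u v v' /psiP[k [-> H]] /psiP[k' [/pt_hom_ext <- H']].
    exact: rel_per_trans (rel_per_sym H) H'.
  - move=> u /chiP[k [_ [-> _ _]]]; exists (n ∘ sval k); apply/psiP; exists k.
    by split=> //; apply/domP; exists k.
have fpsi' : @functional_relation _ _ _ a (pe_per E) psi'.
  apply: functional_of => y; rewrite ?perE.
  - by move=> v u /conv/(rel_strict fpsi)[]; rewrite perE.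
  - move=> v v' u u' vv' uu' /conv H; apply/conv.
    by apply: (rel_left fpsi) (rel_right fpsi vv' H); rewrite perE.
  - move=> v u u' /conv/psiP[j [-> jv]] /conv/psiP[k [-> kv]].
    by apply/chiP; exists j, k; split=> //; apply: rel_per_trans jv (rel_per_sym kv).
  - move=> v Hv; have /domP[k ek] := Hv; exists (sval k); apply/conv/psiP.
    by exists k; rewrite -ek.
exists E, (exist _ psi fpsi), (exist _ psi' fpsi').
by split; apply: per_hom_ext; apply: rel_comp_converse => // y u v; split=> /conv.
Qed.

End Realization.

Theorem theorem5p15 (d : Order.disp_t) (C : lexcat) (P : lex_primary_doctrine d C) :
  equivalent_categories
    (tripos_to_topos (full_existential_completion P))
    (exact_completion (points P)).
Proof.
apply: (@fully_faithful_ess_surj_equivalence _ _ (realize P)).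
- exact: realize_full.
- exact: realize_faithful.
- exact: realize_ess_surj.
Qed.
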